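(* The projective structures on $\mathbb C^2$ defined by the first two Painlevé equations $$\text{(PI)}\quad y''=6y^2+x,\qquad\qquad \text{(PII)}\quad y''=2y^3+xy+\alpha\quad(\alpha\in\mathbb C)$$ are not locally foliated: there is no point $p\in\mathbb C^2$ having an open neighborhood on which the projective structure is foliated.
   Context: An equation $y''=A+B\,y'+C\,(y')^2+D\,(y')^3$ with $A,B,C,D$ holomorphic on an open set $U\subset\mathbb C^2$ with coordinates $(x,y)$ defines a projective structure $\Pi$ on $U$. Its geodesic foliation $\mathcal G$ on the projectivized tangent bundle $\mathbb P(T_U)\simeq U\times\mathbb P^1_z$, $z=\frac{dy}{dx}$, is given by the vector field $\partial_x+z\partial_y+(A+Bz+Cz^2+Dz^3)\partial_z$. $\Pi$ is foliated on $U$ if there are holomorphic $1$-forms $\alpha_0,\beta_0,\gamma_0$ on $U$ such that the Riccati equation $dz=\alpha_0z^2+\beta_0z+\gamma_0$ is Frobenius integrable on $\mathbb P(T_U)$ (i.e. $\omega\wedge d\omega=0$ for $\omega=dz-\alpha_0z^2-\beta_0z-\gamma_0$) and the intersection of the resulting Riccati foliation with the contact distribution $dy-z\,dx=0$ is $\mathcal G$, i.e. substituting $z=\frac{dy}{dx}$ in the Riccati equation gives the second order equation defining $\Pi$. *)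

(* Defs.v *)
From HB Require Import structures.
From mathcomp Require Import all_boot all_order all_algebra.
From mathcomp Require Import complex.
From mathcomp Require Import all_classical all_reals all_analysis.

Set Implicit Arguments.
Unset Strict Implicit.
Unset Printing Implicit Defensive.
Import Order.TTheory GRing.Theory Num.Theory.
Import numFieldNormedType.Exports.

Local Open Scope classical_set_scope.
Local Open Scope ring_scope.

(* Everything is set up over a numFieldType K, so that K itself carries its
   canonical normed K-module structure; the intended instance is K := R[i] with
   R : realType, for which differentiability is complex differentiability. *)

Section exterior_calculus.
Context {K : numFieldType} {V : normedModType K}.

Definition holomorphic_on (U : set V) (f : V -> K) : Prop :=
  forall p, U p -> differentiable f p.

(* The first argument is the base point, the second one the tangent vector. *)
Definition one_form := V -> V -> K.
Definition two_form := V -> V -> V -> K.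
Definition three_form := V -> V -> V -> V -> K.

Definition holomorphic_one_form (U : set V) (w : one_form) : Prop :=
  (forall p, U p -> linear (w p : V -> K^o)) /\
  (forall v, holomorphic_on U (fun p => w p v)).

(* dw(u, v) = u(w(v)) - v(w(u)) for the constant vector fields u and v. *)
Definition ext_d (w : one_form) : two_form := fun p u v =>
  'D_u (fun q => w q v) p - 'D_v (fun q => w q u) p.

Definition wedge12 (w : one_form) (e : two_form) : three_form :=
  fun p u v t => w p u * e p v t - w p v * e p u t + w p t * e p u v.

Definition frobenius_integrable (U : set V) (w : one_form) : Prop :=
  forall p, U p -> forall u v t, wedge12 w (ext_d w) p u v t = 0.

End exterior_calculus.
Arguments one_form {K} V.

(* The equation y'' = A + B y' + C y'^2 + D y'^3 on U; a point of K * K is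
   (x, y). *)
Record projective_structure (K : numFieldType) (U : set (K * K)%type) :=
  ProjectiveStructure {
    ps_A : K * K -> K;
    ps_B : K * K -> K;
    ps_C : K * K -> K;
    ps_D : K * K -> K;
    ps_open : open U;
    ps_A_holo : holomorphic_on U ps_A;
    ps_B_holo : holomorphic_on U ps_B;
    ps_C_holo : holomorphic_on U ps_C;
    ps_D_holo : holomorphic_on U ps_D }.

Section foliated.
Context {K : numFieldType}.

(* A point m of (K * K) * K is ((x, y), z), in the affine chart z = dy/dx of the
   projectivized tangent bundle; tangent vectors t = ((dx, dy), dz). *)

Definition geodesic_field (U : set (K * K)%type) (Pi : projective_structure U)
    (m : (K * K) * K) : (K * K) * K :=
  let: (p, z) := m in
  ((1, z), ps_A Pi p + ps_B Pi p * z + ps_C Pi p * z ^+ 2 + ps_D Pi p * z ^+ 3).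

Definition contact_form : one_form ((K * K) * K)%type :=
  fun m t => t.1.2 - m.2 * t.1.1.

Definition riccati_form (alpha beta gamma : one_form (K * K)%type) :
    one_form ((K * K) * K)%type :=
  fun m t => t.2 - alpha m.1 t.1 * m.2 ^+ 2 - beta m.1 t.1 * m.2 - gamma m.1 t.1.

(* Meaningful only for V an open subset of U. *)
Definition foliated_on (U : set (K * K)%type) (Pi : projective_structure U)
    (V : set (K * K)%type) : Prop :=
  exists alpha beta gamma : one_form (K * K)%type,
    [/\ holomorphic_one_form V alpha, holomorphic_one_form V beta,
        holomorphic_one_form V gamma,
        frobenius_integrable (V `*` [set: K]) (riccati_form alpha beta gamma) &
        forall m, V m.1 -> forall t,
          (riccati_form alpha beta gamma m t = 0 /\ contact_form m t = 0) <->
          (exists c : K, t = c *: geodesic_field Pi m)].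

Definition foliated_near (U : set (K * K)%type) (Pi : projective_structure U)
    (p : K * K) : Prop :=
  exists V, [/\ open V, V p, V `<=` U & foliated_on Pi V].

End foliated.

Section painleve.
Context (K : numFieldType).

Lemma holomorphic_on_cst (U : set (K * K)%type) (c : K) :
  holomorphic_on U (fun=> c).
Proof. by move=> p _; exact: differentiable_cst. Qed.

(* p = (x, y) *)
Definition PI_rhs (p : K * K) : K := 6 * p.2 ^+ 2 + p.1.

Definition PII_rhs (alpha : K) (p : K * K) : K :=
  2 * p.2 ^+ 3 + p.1 * p.2 + alpha.

Lemma differentiable_coord1 (p : K * K) :
  differentiable (fun q : K * K => q.1) p.
Proof. by apply: linear_differentiable => x; exact: cvg_fst. Qed.

Lemma differentiable_coord2 (p : K * K) :
  differentiable (fun q : K * K => q.2) p.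
Proof. by apply: linear_differentiable => x; exact: cvg_snd. Qed.

Lemma PI_rhs_holo : holomorphic_on [set: K * K] PI_rhs.
Proof.
move=> p _; have d1 := differentiable_coord1 p.
have d2 := differentiable_coord2 p.
apply: (@differentiableD _ _ _ (fun q : K * K => 6 * q.2 ^+ 2)) => //.
apply: differentiableM; first exact: differentiable_cst.
by rewrite -exprfctE; exact: differentiableX.
Qed.

Lemma PII_rhs_holo (alpha : K) : holomorphic_on [set: K * K] (PII_rhs alpha).
Proof.
move=> p _; have d1 := differentiable_coord1 p.
have d2 := differentiable_coord2 p.
apply: (@differentiableD _ _ _ (fun q : K * K => 2 * q.2 ^+ 3 + q.1 * q.2));
  last exact: differentiable_cst.
apply: (@differentiableD _ _ _ (fun q : K * K => 2 * q.2 ^+ 3));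
  last exact: differentiableM.
apply: differentiableM; first exact: differentiable_cst.
by rewrite -exprfctE; exact: differentiableX.
Qed.

Definition PainleveI : projective_structure [set: K * K] :=
  ProjectiveStructure openT PI_rhs_holo (@holomorphic_on_cst _ 0)
    (@holomorphic_on_cst _ 0) (@holomorphic_on_cst _ 0).

Definition PainleveII (alpha : K) : projective_structure [set: K * K] :=
  ProjectiveStructure openT (@PII_rhs_holo alpha) (@holomorphic_on_cst _ 0)
    (@holomorphic_on_cst _ 0) (@holomorphic_on_cst _ 0).

End painleve.

(* Main.v *)
Require Import Defs.
From mathcomp Require Import all_boot all_order all_algebra.
From mathcomp Require Import complex.
From mathcomp Require Import all_classical all_reals all_analysis.
From mathcomp Require Import ring.

(* On U the Riccati form must be dz - a z^2 dx + (g dx + a dy) z - A dx - g dy,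
   and integrability reads
     a_y = a^2,   g_y = a_x + 2 a g,   g_x = A_y + a A - g^2.
   If a vanishes identically, then g does not depend on y, hence neither does
   A_y = g_x + g^2.  Otherwise put b = 1/a near a point where a <> 0: b_y = -1,
   so b_x does not depend on y, and G = b^2 g satisfies G_y = -b_x.  Hence b, G
   and G_x are affine in y, while
     b^2 G_x = 2 b_x b G + b^4 A_y + b^3 A - G^2.
   If A is a polynomial of degree n >= 2 in y, the terms b^4 A_y + b^3 A add up to
   degree n + 3 >= 5, whereas all the other ones have degree at most 3.  Since
   b_x is, up to sign, a difference quotient of G in y, second derivatives (hence
   analyticity) are not needed. *)

Set Implicit Arguments.
Unset Strict Implicit.
Unset Printing Implicit Defensive.
Import Order.TTheory GRing.Theory Num.Theory.
Import numFieldNormedType.Exports.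
Local Open Scope classical_set_scope.
Local Open Scope ring_scope.

(** * Functions with zero complex derivative on a ball *)

(* The type R[i] only acquires its normed structure as an instance of
   numFieldType, hence the detour through an abstract K with an embedding of R. *)
Section real_lines.
Context (R : realType) (K : numFieldType).
Variables (iota : {rmorphism R -> K}) (re : K -> R).
Hypothesis reB : {morph re : z w / z - w}.
Hypothesis iota_norm : forall s, `|iota s| = iota `|s|.
Hypothesis iota_lt : {mono iota : s t / s < t}.
Hypothesis iota_small : forall e : K, 0 < e -> exists2 d : R, 0 < d & iota d <= e.
Hypothesis re_le : forall z, iota `|re z| <= `|z|.

(** Since [re] is additive and does not increase norms, each real difference quotient along the line
    is at most [|w|] times a difference quotient of [f], which tends to 0. *)
Lemma is_derive_re_line (f : K -> K) (z w : K) (t : R) :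
  is_derive (z + iota t * w) 1 f 0 ->
  is_derive t 1 (fun s => re (f (z + iota s * w))) 0.
Proof.
have [->|w0] := eqVneq w 0.
  move=> _.
  have -> : (fun s => re (f (z + iota s * 0))) = cst (re (f z)).
    by apply/funext => s; rewrite mulr0 addr0.
  exact: is_derive_cst.
have nw0 : 0 < `|w| by rewrite normr_gt0.
move=> [df dE].
have cf : h^-1 *: (f (h *: 1 + (z + iota t * w)) - f (z + iota t * w))
    @[h --> 0^'] --> (0 : K).
  by have := df : _ --> 'D_1 f _; rewrite dE.
suff cg : h^-1 *: (re (f (z + iota (h *: 1 + t) * w)) - re (f (z + iota t * w)))
    @[h --> 0^'] --> (0 : R).
  apply: DeriveDef; first by apply/cvg_ex; exists 0.
  exact: cvg_lim cg.
apply/cvgr0Pnorm_lt => e e0.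
have ie0 : 0 < iota e by rewrite -(rmorph0 iota) iota_lt.
(* A real increment [h] is the increment [iota h * w] in [K], whence the factor [|w|] in both
   thresholds. [iota_small] then turns a radius in [K] into a real one. *)
have e1 : 0 < iota e / `|w| by rewrite divr_gt0.
move/cvgr0Pnorm_lt : cf => /(_ _ e1) [d /= d0 Hd].
have [r r0 rd] := iota_small (divr_gt0 d0 nw0).
exists r => //= h /= + h0; rewrite sub0r normrN => hr.
have := Hd (iota h * w); rewrite /= sub0r normrN normrM iota_norm.
have ih0 : iota h != 0 by rewrite fmorph_eq0.
have -> : iota `|h| * `|w| < d.
  by rewrite -ltr_pdivlMr//; apply: lt_le_trans rd; rewrite iota_lt.
move=> /(_ isT); rewrite mulf_neq0// => /(_ isT).
have -> : (iota h * w)%:A + (z + iota t * w) = z + iota (h *: 1 + t) * w.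
  by rewrite [(_ * _)%:A]mulr1 [h *: 1]mulr1 rmorphD/=; ring.
rewrite !normrZ normfV normrM iota_norm invfM mulrAC ltr_pM2r ?invr_gt0//.
move=> He; rewrite -iota_lt; apply: le_lt_trans He.
rewrite rmorphM/= -reB normfV fmorphV ler_pM2l ?re_le//.
by rewrite invr_gt0 -iota_norm normr_gt0.
Qed.

(** The segment from [z] to [y] stays in the ball, so the real mean value theorem applies to [re] of
    [f] along it. *)
Lemma derive0_ball_re (f : K -> K) (z : K) (r : K) :
  (forall y, ball z r y -> is_derive y 1 f 0) ->
  forall y, ball z r y -> re (f y) = re (f z).
Proof.
move=> df y zy.
have seg (t : R) : 0 <= t <= 1 -> ball z r (z + iota t * (y - z)).
  move=> /andP[t0 t1]; move: zy; rewrite -!ball_normE/=.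
  rewrite opprD addrA subrr sub0r normrN normrM iota_norm (ger0_norm t0).
  rewrite -[`|z - y|]normrN opprB; apply: le_lt_trans.
  rewrite ler_piMl// -(rmorph1 iota).
  by move: t1; rewrite !le_eqVlt iota_lt => /orP[/eqP->|->]; rewrite ?eqxx ?orbT.
pose g (s : R) := re (f (z + iota s * (y - z))).
have dg (t : R) : 0 <= t <= 1 -> is_derive t 1 g 0.
  by move=> /seg ht; apply: is_derive_re_line; exact: df.
have cg : {within `[0, 1], continuous g}.
  apply: derivable_within_continuous => t; rewrite in_itv/= => ht.
  exact: (@ex_derive _ _ _ _ _ _ _ (dg _ ht)).
have [|c _] := @MVT_segment R g (fun=> 0) 0 1 ler01 _ cg.
  by move=> t; rewrite in_itv/= => /andP[/ltW t0 /ltW t1]; apply: dg; rewrite t0.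
rewrite mul0r /g rmorph0 rmorph1 mul0r mul1r addr0 [z + _]addrC subrK.
by move/eqP; rewrite subr_eq0 => /eqP.
Qed.
End real_lines.

(** The real and imaginary parts are treated separately by the mean value theorem. This is the one
    analytic fact about [R[i]] that the argument uses; the later sections take it as the hypothesis
    [derive0_ball] on [K]. *)
Lemma complex_derive0_ball (R : realType)
    (f : (R[i]%C : numFieldType) -> (R[i]%C : numFieldType))
    (z r : (R[i]%C : numFieldType)) :
  (forall y, ball z r y -> is_derive y 1 f 0) ->
  forall y, ball z r y -> f y = f z.
Proof.
pose K : numFieldType := R[i]%C.
pose io : {rmorphism R -> R[i]%C} := real_complex R.
have io_norm (s : R) : `|io s : K| = io `|s|.
  by rewrite /io normc_def/= expr0n/= addr0 sqrtr_sqr.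
have io_lt : {mono io : s t / s < t} by move=> s t; rewrite ltcR.
have io_small (e : K) : 0 < e -> exists2 d : R, 0 < d & (io d : K) <= e.
  (* In the order of [R[i]] a positive element is real, so its real part serves as the required
     bound. *)
  move=> e0; have rE : io (complex.Re e) = e.
    by apply: RRe_real; exact: gtr0_real.
  exists (complex.Re e); last by rewrite rE.
  by rewrite -io_lt rE rmorph0.
have ReB : {morph (@complex.Re R : K -> R) : z w / z - w} by move=> [a b] [c d].
have ImB : {morph (@complex.Im R : K -> R) : z w / z - w} by move=> [a b] [c d].
have Im_le (w : K) : io `|complex.Im w| <= `|w|.
  rewrite normc_def lecR -sqrtr_sqr ler_wsqrtr// lerDr; exact: sqr_ge0.
move=> df y zy.
have HRe := @derive0_ball_re R K io _ ReB io_norm io_lt io_small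
  (@normc_ge_Re R) f z r df y zy.
have HIm := @derive0_ball_re R K io _ ImB io_norm io_lt io_small
  Im_le f z r df y zy.
by apply/eqP; rewrite eq_complex HRe HIm !eqxx.
Qed.

(** * Vanishing cubics, and partial derivatives in two variables *)

Lemma cubic_eq0 (K : numFieldType) (c0 c1 c2 c3 : K) :
  (forall z, c3 * z ^+ 3 + c2 * z ^+ 2 + c1 * z + c0 = 0) ->
  [/\ c0 = 0, c1 = 0, c2 = 0 & c3 = 0].
Proof.
pose P z := c3 * z ^+ 3 + c2 * z ^+ 2 + c1 * z + c0 => HP.
have P0 z : P z = 0 by exact: HP.
(* The coefficients are recovered from the values of [P] at -1, 0, 1 and 2 by finite differences. *)
have e0 : c0 = P 0 by rewrite /P; ring.
have e2 : c2 = (P 1 + P (-1) - 2 * P 0) / 2 by rewrite /P; field.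
have e3 : c3 = (P 2 - 3 * P 1 + 3 * P 0 - P (-1)) / (2 * 3).
  by rewrite /P; field.
have e1 : c1 = P 1 - c2 - c3 - P 0 by rewrite /P; ring.
by rewrite e1 e0 e2 e3 !P0 !(mulr0, subr0, addr0, mul0r, oppr0).
Qed.

Section directional_derivatives.
Context {K : numFieldType}.
Local Notation e1 := ((1, 0) : (K * K)%type).
Local Notation e2 := ((0, 1) : (K * K)%type).

Section arithmetic.
Context {V : normedModType K}.
Implicit Types (f g : V -> K) (p v : V) (df dg : K).

Lemma is_derive_mul f g p v df dg :
  is_derive p v f df -> is_derive p v g dg ->
  is_derive p v (fun q => f q * g q) (f p * dg + g p * df).
Proof. by move=> Hf Hg; exact: is_deriveM. Qed.

Lemma is_derive_exp f n p v df :
  is_derive p v f df ->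
  is_derive p v (fun q => f q ^+ n) (n%:R * f p ^+ n.-1 * df).
Proof.
move=> Hf; have -> : (fun q => f q ^+ n) = f ^+ n by rewrite exprfctE.
exact: is_deriveX.
Qed.

Lemma is_derive_sub f g p v df dg :
  is_derive p v f df -> is_derive p v g dg ->
  is_derive p v (fun q => f q - g q) (df - dg).
Proof. by move=> Hf Hg; exact: is_deriveB. Qed.

Lemma is_derive_add f g p v df dg :
  is_derive p v f df -> is_derive p v g dg ->
  is_derive p v (fun q => f q + g q) (df + dg).
Proof. by move=> Hf Hg; exact: is_deriveD. Qed.

Lemma is_derive_inv f p v df :
  f p != 0 -> is_derive p v f df ->
  is_derive p v (fun q => (f q)^-1) (- (f p) ^- 2 * df).
Proof.
move=> fp0 [dfp <-]; apply: DeriveDef; first exact: derivableV.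
by rewrite deriveV.
Qed.

End arithmetic.

Lemma is_derive_fst (V W : normedModType K) (f : V -> K) (p : V * W) v df :
  is_derive p.1 v.1 f df -> is_derive p v (fun m => f m.1) df.
Proof. by case=> dfp dfE; apply: DeriveDef. Qed.

Lemma is_derive_snd (V W : normedModType K) (f : W -> K) (p : V * W) v df :
  is_derive p.2 v.2 f df -> is_derive p v (fun m => f m.2) df.
Proof. by case=> dfp dfE; apply: DeriveDef. Qed.

(** The two difference quotients are the same function of [h]. This lets directional derivatives on
    [K * K] be handled as one-variable derivatives on the lines of a box. *)
Lemma is_derive_dy (f : K * K -> K) (x y df : K) :
  is_derive (x, y) e2 f df <-> is_derive y 1 (fun s => f (x, s)) df.
Proof.
have E : (fun h : K => h^-1 *: ((f \o shift (x, y)) (h *: e2) - f (x, y))) =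
         (fun h => h^-1 *: (((fun s => f (x, s)) \o shift y) (h *: 1) - f (x, y))).
  apply/funext => h /=; congr (_ *: (f _ - _)).
  by congr pair; rewrite /= scaler0 add0r.
by split=> -[dfp dfE]; apply: DeriveDef;
  move: dfp dfE; rewrite /derivable /derive E.
Qed.

Lemma is_derive_dx (f : K * K -> K) (x y df : K) :
  is_derive (x, y) e1 f df <-> is_derive x 1 (fun s => f (s, y)) df.
Proof.
have E : (fun h : K => h^-1 *: ((f \o shift (x, y)) (h *: e1) - f (x, y))) =
         (fun h => h^-1 *: (((fun s => f (s, y)) \o shift x) (h *: 1) - f (x, y))).
  apply/funext => h /=; congr (_ *: (f _ - _)).
  by congr pair; rewrite /= scaler0 add0r.
by split=> -[dfp dfE]; apply: DeriveDef;
  move: dfp dfE; rewrite /derivable /derive E.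
Qed.

Lemma is_derive_horner (p : {poly K}) (y : K) : is_derive y 1 (horner p) p^`().[y].
Proof.
elim/poly_ind: p => [|p c IH].
  have -> : horner (0 : {poly K}) = cst 0 by apply/funext => s; rewrite horner0.
  by rewrite deriv0 horner0; exact: is_derive_cst.
have -> : horner (p * 'X + c%:P) = (fun s => p.[s] * s + c).
  by apply/funext => s; rewrite hornerMXaddC.
apply: is_derive_eq.
rewrite derivMXaddC !hornerE [y *: _]mulrC [_%:A]mulr1; ring.
Qed.

Lemma is_derive_riccati (a b c : K * K -> K) (k : K) (m w : (K * K) * K) da db dc :
  is_derive m.1 w.1 a da -> is_derive m.1 w.1 b db -> is_derive m.1 w.1 c dc ->
  is_derive m w (fun m => k - a m.1 * m.2 ^+ 2 - b m.1 * m.2 - c m.1)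
    (- (da * m.2 ^+ 2 + db * m.2 + dc + (2 * a m.1 * m.2 + b m.1) * w.2)).
Proof.
move=> Ha Hb Hc.
have Hz : is_derive m w (fun m => m.2) w.2.
  by apply: (@is_derive_snd _ _ id); exact: is_derive_id.
apply: is_derive_eq.
  apply: is_derive_sub; last exact: is_derive_fst Hc.
  apply: is_derive_sub; last by apply: is_derive_mul Hz; exact: is_derive_fst Hb.
  apply: (is_derive_sub (is_derive_cst _ _ _)).
  by apply: is_derive_mul (is_derive_exp _ Hz); exact: is_derive_fst Ha.
by rewrite /=; ring.
Qed.

End directional_derivatives.

(** * From integrability of the Riccati form to the equations for a and g *)

Section structure_equations.
Context {K : numFieldType} (U : set (K * K)%type).
Local Notation e1 := ((1, 0) : (K * K)%type).
Local Notation e2 := ((0, 1) : (K * K)%type).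
Variable Pi : projective_structure U.
Hypothesis (B0 : forall p, ps_B Pi p = 0) (C0 : forall p, ps_C Pi p = 0).
Hypothesis D0 : forall p, ps_D Pi p = 0.

Lemma one_form_coord (V : set (K * K)%type) (w : one_form (K * K)%type) q (x y : K) :
  holomorphic_one_form V w -> V q -> w q (x, y) = x * w q e1 + y * w q e2.
Proof.
move=> [lw _] /lw lq.
have w0 : w q 0 = 0.
  by have := lq (-1) 0 0; rewrite scaler0 addr0 scaleN1r addNr.
have E : ((x, y) : (K * K)%type) = x *: e1 + (y *: e2 + 0).
  by rewrite addr0; congr pair; rewrite /= [_ *: 1]mulr1 scaler0 ?add0r ?addr0.
by rewrite [LHS](congr1 (w q) E) !lq w0 addr0.
Qed.

(** The Riccati form evaluated on the geodesic field at [(q, z)] is minus a cubic polynomial in [z].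
    It vanishes for every [z], so all four coefficients are zero. *)
Lemma riccati_matching (V : set (K * K)%type)
    (alpha beta gamma : one_form (K * K)%type) :
  holomorphic_one_form V alpha -> holomorphic_one_form V beta ->
  holomorphic_one_form V gamma ->
  (forall m, V m.1 -> forall t,
    (riccati_form alpha beta gamma m t = 0 /\ contact_form m t = 0) <->
    (exists c : K, t = c *: geodesic_field Pi m)) ->
  forall q, V q ->
  [/\ gamma q e1 = ps_A Pi q, beta q e1 = - gamma q e2,
      beta q e2 = - alpha q e1 & alpha q e2 = 0].
Proof.
move=> ha hb hc geo q Vq.
have H z : alpha q e2 * z ^+ 3 + (alpha q e1 + beta q e2) * z ^+ 2 +
    (beta q e1 + gamma q e2) * z + (gamma q e1 - ps_A Pi q) = 0.
  have [+ _] : riccati_form alpha beta gamma (q, z) (geodesic_field Pi (q, z)) = 0 /\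
    contact_form (q, z) (geodesic_field Pi (q, z)) = 0.
    by apply/geo => //; exists 1; rewrite scale1r.
  rewrite /riccati_form /= B0 C0 D0.
  rewrite (one_form_coord _ _ ha)// (one_form_coord _ _ hb)//.
  rewrite (one_form_coord _ _ hc)//.
  by move=> /eqP; rewrite -oppr_eq0 => /eqP E; apply: etrans E; ring.
have [/eqP + /eqP + /eqP +] := cubic_eq0 H.
rewrite subr_eq0 !addr_eq0 => /eqP-> /eqP-> /eqP e ->; split=> //.
by rewrite e opprK.
Qed.

Lemma derive_riccati_form (V : set (K * K)%type)
    (alpha beta gamma : one_form (K * K)%type) :
  holomorphic_one_form V alpha -> holomorphic_one_form V beta ->
  holomorphic_one_form V gamma ->
  forall (q : K * K) (z : K) (w t : (K * K) * K), V q ->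
  'D_w (fun m => riccati_form alpha beta gamma m t) (q, z) =
  - ('D_(w.1) (alpha ^~ t.1) q * z ^+ 2 + 'D_(w.1) (beta ^~ t.1) q * z +
     'D_(w.1) (gamma ^~ t.1) q + (2 * alpha q t.1 * z + beta q t.1) * w.2).
Proof.
move=> [_ ha] [_ hb] [_ hc] q z w t Vq.
apply: derive_val.
apply: (@is_derive_riccati _ (alpha ^~ t.1) (beta ^~ t.1) (gamma ^~ t.1));
  apply: derivableP; apply: diff_derivable; [exact: ha|exact: hb|exact: hc].
Qed.

Lemma structure_equations (V : set (K * K)%type) : open V -> foliated_on Pi V ->
  exists a g : K * K -> K,
    (forall q, V q -> differentiable a q /\ differentiable g q) /\
    (forall q, V q -> [/\ 'D_e2 a q = a q ^+ 2,
       'D_e2 g q = 'D_e1 a q + 2 * a q * g q &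
       'D_e1 g q = 'D_e2 (ps_A Pi) q + a q * ps_A Pi q - g q ^+ 2]).
Proof.
move=> oV [alpha [beta [gamma [ha hb hc frob geo]]]].
have M := riccati_matching ha hb hc geo.
(* By [riccati_matching] the three forms on [V] are a dx, -(g dx + a dy) and A dx + g dy. *)
pose a := alpha ^~ e1; pose g := gamma ^~ e2.
exists a, g; split=> q Vq; first by split; [exact: ha.2|exact: hc.2].
(* The matching relations hold on the whole open set [V], hence may be differentiated at [q]. *)
have nearV (f h : K * K -> K) u : (forall p, V p -> f p = h p) ->
    'D_u f q = 'D_u h q.
  move=> fh; apply: near_eq_derive; apply: filterS fh _.
  exact: open_nbhs_nbhs.
have dN (f h : K * K -> K) u : differentiable h q ->
    (forall p, V p -> f p = - h p) -> 'D_u f q = - 'D_u h q.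
  by move=> dh /nearV ->; rewrite deriveN//; exact: diff_derivable.
have da2 u : 'D_u (alpha ^~ e2) q = 0.
  by rewrite (nearV _ (cst 0)) ?derive_cst// => p /M[].
have dc1 u : 'D_u (gamma ^~ e1) q = 'D_u (ps_A Pi) q.
  by apply: nearV => p /M[].
have db1 u : 'D_u (beta ^~ e1) q = - 'D_u g q.
  by apply: dN => [|p /M[]//]; exact: hc.2.
have db2 u : 'D_u (beta ^~ e2) q = - 'D_u a q.
  by apply: dN => [|p /M[]//]; exact: ha.2.
have w0 (w : one_form (K * K)%type) p : holomorphic_one_form V w -> V p -> w p 0 = 0.
  by move=> hw Vp; rewrite (one_form_coord 0 0 hw Vp) !mul0r addr0.
have d0 (w : one_form (K * K)%type) u : holomorphic_one_form V w ->
    'D_u (w ^~ 0) q = 0.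
  by move=> hw; rewrite (nearV _ (cst 0)) ?derive_cst// => p; exact: w0.
have [mc1 mb1 mb2 ma2] := M q Vq.
have H z : 0 * z ^+ 3 + ('D_e2 a q - a q ^+ 2) * z ^+ 2 +
    ('D_e1 a q + 2 * a q * g q - 'D_e2 g q) * z +
    ('D_e2 (ps_A Pi) q + a q * ps_A Pi q - g q ^+ 2 - 'D_e1 g q) = 0.
  (* On the coordinate frame of x, y, z the integrability condition is a quadratic polynomial in
     [z]; its three coefficients are the structure equations. *)
  have := frob (q, z) (conj Vq I) (e1, 0) (e2, 0) (0, 1).
  rewrite /wedge12 /ext_d !(derive_riccati_form ha hb hc _ _ _ Vq)/=.
  rewrite !da2 !dc1 !db1 !db2 !(d0 _ _ ha, d0 _ _ hb, d0 _ _ hc).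
  rewrite /riccati_form/= !(w0 _ _ ha Vq, w0 _ _ hb Vq, w0 _ _ hc Vq).
  rewrite mc1 mb1 mb2 ma2 !derive0 -/a -/g -/(a q) -/(g q) => E.
  by apply: etrans E; ring.
have [] := cubic_eq0 H.
by move=> /eqP + /eqP + /eqP + _; rewrite !subr_eq0 => /eqP -> /eqP -> /eqP ->.
Qed.

End structure_equations.

(** * Polynomial identities on a vertical line and the degree count *)

Lemma poly_eq_ball (K : numFieldType) (p q : {poly K}) (z r : K) :
  0 < r -> (forall y, ball z r y -> p.[y] = q.[y]) -> p = q.
Proof.
move=> r0 pq; apply/eqP; rewrite -subr_eq0; apply: contraT => pn0.
(* These are distinct roots of [p - q], one too many for its degree; the shift to [i.+2] keeps them
   strictly inside the ball. *)
pose s := [seq z + r / (i.+2)%:R | i <- iota 0 (size (p - q))].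
have : (size s < size (p - q)%R)%N.
  apply: max_poly_roots => //.
    apply/allP => y /mapP[i _ ->]; apply/rootP; rewrite hornerD hornerN pq ?subrr//.
    rewrite -ball_normE/= opprD addrA subrr sub0r normrN gtr0_norm ?divr_gt0//.
    by rewrite ltr_pdivrMr// ltr_pMr// ltr1n.
  rewrite map_inj_uniq ?iota_uniq// => i j /addrI /(mulfI (lt0r_neq0 r0)) /invr_inj.
  by move=> /eqP; rewrite eqr_nat => /eqP [].
by rewrite size_map size_iota ltnn.
Qed.

Lemma size_gt_coef (K : nzRingType) (p : {poly K}) n : p`_n != 0 -> (n < size p)%N.
Proof. by rewrite ltnNge; apply: contraNN => h; rewrite nth_default. Qed.

(** Here [u], [G], [H] stand for b, G, G_x on a line of constant x, and [k] for 2 b_x. The terms in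
    [P] combine into u^3 (u P' + P), of degree at least 5, against degree at most 3 for the rest. *)
Lemma fibre_identity_false (K : numFieldType) (P u G H : {poly K}) (c k : K) :
  (2 < size P)%N -> u = c%:P - 'X -> (size G <= 2)%N -> (size H <= 2)%N ->
  u ^+ 2 * H = k *: (u * G) + u ^+ 4 * P^`() + u ^+ 3 * P - G ^+ 2 -> False.
Proof.
move=> sP uE sG sH E.
pose Q := u * P^`() + P.
have su : size u = 2 by rewrite uE -opprB size_polyN size_XsubC.
have u0 : u != 0 by rewrite -size_poly_gt0 su.
have EQ : u ^+ 3 * Q = u ^+ 2 * H - k *: (u * G) + G ^+ 2.
  by rewrite E /Q -!mul_polyC; ring.
have [n nE] : exists n, size P = n.+3.
  by case: (size P) sP => [|[|[|n]]]// _; exists n.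
have PL : P`_n.+2 != 0.
  by have := lead_coef_eq0 P; rewrite lead_coefE nE /= => ->;
    rewrite -size_poly_gt0 nE.
(* Since [u] has leading coefficient -1, this coefficient is 1 - (n + 2) = -(n + 1) times the
   leading coefficient of [P]. In degree 1 the analogous coefficient would cancel. *)
have QL : Q`_n.+2 != 0.
  have P3 : P`_n.+3 = 0 by rewrite nth_default ?nE.
  rewrite coefD uE mulrBl coefB coefCM coefXM /= !coef_deriv P3 mul0rn mulr0 sub0r.
  rewrite -mulNrn -[X in _ + X]mulr1n -[P`_n.+2 *+ 1]opprK -mulNrn -mulrnBr//.
  by rewrite mulrn_eq0 oppr_eq0 (negbTE PL).
have sQ : (2 < size Q)%N by apply: leq_trans (size_gt_coef QL).
have Q0 : Q != 0 by rewrite -size_poly_gt0; apply: leq_trans sQ.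
have sL : size (u ^+ 3 * Q)%R = (size Q + 3)%N.
  rewrite size_mul ?expf_neq0// -[size (u ^+ 3)]prednK ?size_poly_gt0 ?expf_neq0//.
  by rewrite size_exp su addnC addnS.
(* The size is the degree plus one; the bound 4 is attained only by the estimate for
   [u ^+ 2 * H]. *)
have : (size (u ^+ 3 * Q)%R <= 4)%N.
  have sX (p q : {poly K}) m n' k' : (size p <= m)%N ->
      (size q <= n')%N -> ((m + n').-1 <= k')%N -> (size (p * q)%R <= k')%N.
    move=> hp hq; apply: leq_trans; apply: leq_trans (size_polyMleq _ _) _.
    by rewrite -!subn1 leq_sub2r// leq_add.
  have su2 : (size (u ^+ 2)%R <= 3)%N by rewrite expr2 (sX _ _ 2 2)// su.
  rewrite EQ; apply: leq_trans (size_polyD _ _) _; rewrite geq_max.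
  apply/andP; split.
    apply: leq_trans (size_polyD _ _) _; rewrite geq_max size_polyN.
    apply/andP; split.
      exact: (sX _ _ 3 2).
    apply: leq_trans (size_scale_leq _ _) _.
      by apply: (sX _ _ 2 2) => //; rewrite su.
  by rewrite expr2; exact: (sX _ _ 2 2).
by rewrite sL addnC; case: (size Q) sQ => [|[|[|m]]].
Qed.

(** * The structure equations on a box, for a zero and for a nowhere zero *)

Section fibres.
Context {K : numFieldType}.
Hypothesis derive0_ball : forall (f : K -> K) (z r : K),
  (forall y, ball z r y -> is_derive y 1 f 0) -> forall y, ball z r y -> f y = f z.

Lemma affine_ball (f : K -> K) (z r c : K) :
  (forall y, ball z r y -> is_derive y 1 f c) ->
  forall y, ball z r y -> f y = f z + c * (y - z).
Proof.
move=> df y zy.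
have H s : ball z r s -> is_derive s 1 (fun s => f s - c * s) 0.
  move=> /df dfs.
  have dc := is_derive_mul (is_derive_cst c s 1) (is_derive_id s 1).
  by have := is_derive_sub dfs dc; rewrite /= mulr1 mulr0 addr0 subrr.
have /eqP := derive0_ball H zy.
by rewrite subr_eq => /eqP ->; ring.
Qed.

Section box.
Variables (P : K -> {poly K}) (a g ax : K -> K -> K) (x0 y0 r : K).
Hypothesis (r_gt0 : 0 < r) (sizeP : (2 < size (P x0))%N).
Hypothesis a_dy : forall x y, ball x0 r x -> ball y0 r y ->
  is_derive y 1 (a x) (a x y ^+ 2).
Hypothesis a_dx : forall x y, ball x0 r x -> ball y0 r y ->
  is_derive x 1 (a ^~ y) (ax x y).
Hypothesis g_dy : forall x y, ball x0 r x -> ball y0 r y ->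
  is_derive y 1 (g x) (ax x y + 2 * a x y * g x y).
Hypothesis g_dx : forall x y, ball x0 r x -> ball y0 r y ->
  is_derive x 1 (g ^~ y) ((P x)^`().[y] + a x y * (P x).[y] - g x y ^+ 2).

Let x00 : ball x0 r x0. Proof. exact: ballxx. Qed.
Let y00 : ball y0 r y0. Proof. exact: ballxx. Qed.

(** This differentiates in x an identity valid throughout the box. *)
Let eq_dx (f h : K -> K) x df dh : ball x0 r x ->
  (forall s, ball x0 r s -> f s = h s) ->
  is_derive x 1 f df -> is_derive x 1 h dh -> df = dh.
Proof.
move=> x0x fh Hf [_ <-]; case: (@near_eq_is_derive K K K f h x 1 df _ Hf) => //.
by apply: filterS fh _; apply: open_nbhs_nbhs; split=> //; exact: ball_open.
Qed.

Lemma box_zero_false :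
  (forall x y, ball x0 r x -> ball y0 r y -> a x y = 0) -> False.
Proof.
move=> a0.
have ax0 x y : ball x0 r x -> ball y0 r y -> ax x y = 0.
  move=> hx hy.
  apply: (eq_dx (f := a ^~ y) (h := cst 0) hx _ (a_dx hx hy) (is_derive_cst _ _ _)).
  by move=> s hs; exact: a0.
have gE x y : ball x0 r x -> ball y0 r y -> g x y = g x y0.
  move=> hx; apply: derive0_ball => s hs.
  by have := g_dy hx hs; rewrite ax0// a0// mulr0 mul0r addr0.
(* As [g] does not depend on y, the equations for g_x at [y] and at [y0] have equal left sides and
   equal g^2 terms; what remains is the derivative of [P x0]. *)
have /(poly_eq_ball r_gt0) E : forall y, ball y0 r y ->
    (P x0)^`().[y] = ((P x0)^`().[y0])%:P.[y].
  move=> y hy; rewrite !hornerE.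
  have := eq_dx x00 (fun s hs => gE s y hs hy) (g_dx x00 hy) (g_dx x00 y00).
  by rewrite !a0// !mul0r !addr0 gE// => /addIr.
have [n nE] : exists n, size (P x0) = n.+3.
  by case: (size (P x0)) sizeP => [|[|[|n]]]// _; exists n.
have : lead_coef (P x0) == 0.
  (* In the constant derivative the coefficient of index [n.+1], which is n + 2 times the leading
     coefficient of [P x0], must vanish. *)
  have /polyP/(_ n.+1) := E.
  rewrite coefC coef_deriv lead_coefE nE => /eqP.
  by rewrite mulrn_eq0.
by rewrite lead_coef_eq0 -size_poly_eq0 nE.
Qed.

Lemma box_nonzero_false :
  (forall x y, ball x0 r x -> ball y0 r y -> a x y != 0) -> False.
Proof.
move=> a0.
pose b x y := (a x y)^-1.
pose bx x y := - (a x y) ^- 2 * ax x y.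
pose G x y := b x y ^+ 2 * g x y.
(* The product rule for b^2 g, with g_x replaced by its structure equation. *)
pose Gx x y := b x y ^+ 2 * ((P x)^`().[y] + a x y * (P x).[y] - g x y ^+ 2) +
  g x y * (2 * b x y * bx x y).
have b_dx x y : ball x0 r x -> ball y0 r y -> is_derive x 1 (b ^~ y) (bx x y).
  by move=> hx hy; apply: is_derive_inv; [exact: a0|exact: a_dx].
have b_dy x y : ball x0 r x -> ball y0 r y -> is_derive y 1 (b x) (-1).
  move=> hx hy; have := is_derive_inv (a0 x y hx hy) (a_dy hx hy).
  by rewrite mulNr mulVf// expf_neq0// a0.
have bE x y : ball x0 r x -> ball y0 r y -> b x y = b x y0 - (y - y0).
  by move=> hx hy; rewrite (affine_ball (b_dy x ^~ hx) hy) mulN1r.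
have bxE x y : ball x0 r x -> ball y0 r y -> bx x y = bx x y0.
  move=> hx hy.
  have H := is_derive_sub (b_dx _ _ hx y00) (is_derive_cst (y - y0) x 1).
  by rewrite (eq_dx hx (fun s hs => bE s y hs hy) (b_dx _ _ hx hy) H) subr0.
have G_dx x y : ball x0 r x -> ball y0 r y -> is_derive x 1 (G ^~ y) (Gx x y).
  move=> hx hy.
  exact: is_derive_mul (is_derive_exp _ (b_dx _ _ hx hy)) (g_dx hx hy).
(* With b_y = -1 and a b = 1, the terms -2 b g and 2 a b^2 g cancel, leaving b^2 a_x = -b_x. *)
have G_dy x y : ball x0 r x -> ball y0 r y -> is_derive y 1 (G x) (- bx x y0).
  move=> hx hy; rewrite -(bxE x y hx hy).
  have := is_derive_mul (is_derive_exp 2 (b_dy _ _ hx hy)) (g_dy hx hy).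
  congr (is_derive _ _ _ _); rewrite /bx /b; field; exact: a0.
have GE x y : ball x0 r x -> ball y0 r y -> G x y = G x y0 + - bx x y0 * (y - y0).
  by move=> hx; apply: affine_ball => s hs; exact: G_dy.
pose d := r / 2.
have d0 : d != 0 by rewrite lt0r_neq0// divr_gt0.
have y01 : ball y0 r (y0 + d).
  rewrite -ball_normE/= opprD addrA subrr sub0r normrN gtr0_norm ?divr_gt0//.
  by rewrite ltr_pdivrMr// ltr_pMr// ltr1n.
(* Writing the slope -b_x as the difference quotient of [G] between [y0] and [y0 + d] makes the
   affine formula differentiable in x using only [Gx]; [e] is the x-derivative of this slope at
   [x0]. *)
have GE1 x y : ball x0 r x -> ball y0 r y ->
    G x y = G x y0 + (G x (y0 + d) - G x y0) * ((y - y0) / d).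
  move=> hx hy; rewrite (GE x (y0 + d))// (GE x y)//; field; exact: d0.
pose e := (Gx x0 (y0 + d) - Gx x0 y0) / d.
have GxE y : ball y0 r y -> Gx x0 y = Gx x0 y0 + e * (y - y0).
  move=> hy; have D1 := is_derive_sub (G_dx _ _ x00 y01) (G_dx _ _ x00 y00).
  have D2 := is_derive_mul D1 (is_derive_cst ((y - y0) / d) x0 1).
  have D3 := is_derive_add (G_dx _ _ x00 y00) D2.
  rewrite (eq_dx x00 (fun s hs => GE1 s y hs hy) (G_dx _ _ x00 hy) D3) /e /=.
  by rewrite mulr0 add0r /cst; field.
pose p (k c : K) : {poly K} := k%:P + c *: ('X - y0%:P).
have p_size k c : (size (p k c) <= 2)%N.
  apply: leq_trans (size_polyD _ _) _; rewrite geq_max; apply/andP; split.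
    by apply: leq_trans (size_polyC_leq1 _) _.
  by apply: leq_trans (size_scale_leq _ _) _; rewrite size_XsubC.
(* The affine function b(x0, y0) - (y - y0), arranged as a constant minus the variable. *)
pose u : {poly K} := (b x0 y0 + y0)%:P - 'X.
pose Gp := p (G x0 y0) (- bx x0 y0); pose Gxp := p (Gx x0 y0) e.
apply: (@fibre_identity_false K (P x0) u Gp Gxp (b x0 y0 + y0) (2 * bx x0 y0));
  rewrite ?p_size//.
apply: (poly_eq_ball (z := y0) r_gt0) => y hy.
have uy : u.[y] = b x0 y by rewrite /u !hornerE (bE x0 y)//; ring.
have Gy : Gp.[y] = G x0 y by rewrite /Gp /p !hornerE (GE x0 y).
have Gxy : Gxp.[y] = Gx x0 y by rewrite /Gxp /p !hornerE (GxE y).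
clearbody u Gp Gxp; rewrite !(hornerD, hornerN, hornerM, horner_exp, hornerZ).
rewrite uy Gy Gxy -(bxE x0 y x00 hy).
(* Multiplying [Gx] by b^2 and using a b = 1 and G = b^2 g gives exactly the required identity. *)
by rewrite /Gx /G /b; field; exact: a0.
Qed.

End box.
End fibres.

(** * Reduction of local foliatedness to the two box cases *)

Lemma nbhs_box (K : numFieldType) (W : set (K * K)%type) (q : K * K) : nbhs q W ->
  exists2 r : K, 0 < r & forall x y, ball q.1 r x -> ball q.2 r y -> W (x, y).
Proof. by move=> /nbhs_ballP[r r0 rW]; exists r => // x y hx hy; apply: rW. Qed.

Section not_foliated.
Context {K : numFieldType}.
Local Notation e1 := ((1, 0) : (K * K)%type).
Local Notation e2 := ((0, 1) : (K * K)%type).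
Hypothesis derive0_ball : forall (f : K -> K) (z r : K),
  (forall y, ball z r y -> is_derive y 1 f 0) -> forall y, ball z r y -> f y = f z.

Lemma not_foliated_near (U : set (K * K)%type) (Pi : projective_structure U)
    (P : K -> {poly K}) :
  (forall x y, ps_A Pi (x, y) = (P x).[y]) -> (forall p, ps_B Pi p = 0) ->
  (forall p, ps_C Pi p = 0) -> (forall p, ps_D Pi p = 0) ->
  (forall x, (2 < size (P x))%N) -> forall p, ~ foliated_near Pi p.
Proof.
move=> AP B0 C0 D0 sizeP p [V [oV Vp _ fol]].
have [a [g [diffag eqns]]] := structure_equations B0 C0 D0 oV fol.
have A_dy x y : 'D_e2 (ps_A Pi) (x, y) = (P x)^`().[y].
  apply: derive_val; apply/is_derive_dy.
  have -> : (fun s => ps_A Pi (x, s)) = horner (P x) by apply/funext => s; exact: AP.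
  exact: is_derive_horner.
have a_dy x y : V (x, y) -> is_derive y 1 (fun s => a (x, s)) (a (x, y) ^+ 2).
  move=> Vxy; apply/is_derive_dy; have [<- _ _] := eqns _ Vxy.
  by apply: derivableP; apply: diff_derivable; have [] := diffag _ Vxy.
have a_dx x y : V (x, y) -> is_derive x 1 (fun s => a (s, y)) ('D_e1 a (x, y)).
  move=> Vxy; apply/is_derive_dx.
  by apply: derivableP; apply: diff_derivable; have [] := diffag _ Vxy.
have g_dy x y : V (x, y) -> is_derive y 1 (fun s => g (x, s))
    ('D_e1 a (x, y) + 2 * a (x, y) * g (x, y)).
  move=> Vxy; apply/is_derive_dy; have [_ <- _] := eqns _ Vxy.
  by apply: derivableP; apply: diff_derivable; have [] := diffag _ Vxy.
have g_dx x y : V (x, y) -> is_derive x 1 (fun s => g (s, y))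
    ((P x)^`().[y] + a (x, y) * (P x).[y] - g (x, y) ^+ 2).
  move=> Vxy; apply/is_derive_dx; rewrite -A_dy -AP; have [_ _ <-] := eqns _ Vxy.
  by apply: derivableP; apply: diff_derivable; have [] := diffag _ Vxy.
pose W := V `&` [set q | a q != 0].
(* The structure equations hold on all of [V], so the box may be centred at any [q] in [V] with
   [a q != 0], where continuity keeps [a] nonzero nearby. Otherwise [a] vanishes on [V] and a box
   around [p] serves. *)
have [[q [Vq aq]]|/forallNP noW] := pselect (exists q, W q).
- have [|r r0 box] := @nbhs_box _ W q.
    apply: filterI; first exact: open_nbhs_nbhs.
    exact: cvgr_neq0 (differentiable_continuous (diffag _ Vq).1) aq.
  apply: (box_nonzero_false derive0_ball (P := P)
    (a := fun x y => a (x, y)) (g := fun x y => g (x, y))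
    (ax := fun x y => 'D_e1 a (x, y)) (x0 := q.1) (y0 := q.2) r0 (sizeP _)) =>
    x y hx hy; have [Vxy ?] := box x y hx hy;
    [exact: a_dy|exact: a_dx|exact: g_dy|exact: g_dx|by []].
- have [r r0 box] := nbhs_box (open_nbhs_nbhs (conj oV Vp)).
  apply: (box_zero_false derive0_ball (P := P)
    (a := fun x y => a (x, y)) (g := fun x y => g (x, y))
    (ax := fun x y => 'D_e1 a (x, y)) (x0 := p.1) (y0 := p.2) r0 (sizeP _)) =>
    x y hx hy; have Vxy := box x y hx hy;
    [exact: a_dx|exact: g_dy|exact: g_dx|].
  by apply: contrapT => /eqP axy; apply: (noW (x, y)).
Qed.
End not_foliated.

(** * Painlevé I and II as polynomials of degree 2 and 3 in y *)

Local Open Scope complex_scope.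

Theorem proposition6p1 (R : realType) :
  (~ exists p : R[i] * R[i], foliated_near (PainleveI R[i]) p) /\
  (forall alpha : R[i],
     ~ exists p : R[i] * R[i], foliated_near (PainleveII alpha) p).
Proof.
pose K : numFieldType := R[i].
split=> [[p]|alpha [p]].
- apply: (@not_foliated_near K (@complex_derive0_ball R) _ _
    (fun x : K => 6%:P * 'X ^+ 2 + x%:P)) => // [x y|x].
    by rewrite /= /PI_rhs/= !(hornerD, hornerM, hornerC, horner_exp, hornerX).
  by apply: size_gt_coef; rewrite coefD coefCM coefXn coefC /= mulr1 addr0 pnatr_eq0.
- apply: (@not_foliated_near K (@complex_derive0_ball R) _ _
    (fun x : K => 2%:P * 'X ^+ 3 + x%:P * 'X + alpha%:P)) => // [x y|x].
    by rewrite /= /PII_rhs/= !(hornerD, hornerM, hornerC, horner_exp, hornerX).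
  (* The coefficient 2 of the cubic term gives a size above 3, one more than required. *)
  apply: ltnW; apply: size_gt_coef.
  by rewrite !coefD !coefCM coefXn coefX coefC /= mulr1 mulr0 !addr0 pnatr_eq0.
Qed.
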